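(* If a ring $R$ has a non-negative filtration whose associated graded ring $\mathrm{gr}(R)$ is F-noetherian, the ring $R$ may fail to be F-noetherian, and the failure may occur even if $\mathrm{gr}(R)$ is commutative. That is, there exists a ring $R$ with a non-negative filtration such that $\mathrm{gr}(R)$ is commutative (hence F-noetherian) but $R$ is not F-noetherian.
   Context: All rings have an identity $1$, and subrings contain $1$; ''noetherian'' means left and right noetherian. A ring $R$ is F-noetherian if every finite subset of $R$ is contained in a noetherian subring of $R$ (every commutative ring is F-noetherian). A non-negative filtration of $R$ is an ascending chain $A_0\subset A_1\subset A_2\subset\cdots$ of additive subgroups of $R$ with $1\in A_0$, $A_iA_j\subset A_{i+j}$ and $\bigcup_m A_m=R$; the associated graded ring is $\mathrm{gr}(R)=\bigoplus_{m\ge 0}A_m/A_{m-1}$ with $A_{-1}=0$. *)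

(* Defs.v *)
From HB Require Import structures.
From mathcomp Require Import all_boot all_algebra.
From mathcomp Require Import generic_quotient ring_quotient boolp.

Set Implicit Arguments.
Unset Strict Implicit.
Unset Printing Implicit Defensive.

Import GRing.Theory.
Local Open Scope ring_scope.
Local Open Scope quotient_scope.

(* Rings are [pzRingType]s: associative and unital, possibly noncommutative,
   with the zero ring allowed.  Subsets are boolean predicates; under the
   classical axioms of [boolp] these are all the subsets. *)

Section Subgroup.
Variables (V : zmodType) (S : zmodClosed V).
Record subgroup_of := SubgroupOf { subgroup_val : V; _ : subgroup_val \in S }.
HB.instance Definition _ := [isSub for subgroup_val].
HB.instance Definition _ := [Choice of subgroup_of by <:].
HB.instance Definition _ := [SubChoice_isSubZmodule of subgroup_of by <:].
End Subgroup.

Section Subring.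
Variables (R : pzRingType) (S : subringClosed R).
Record subring_of := SubringOf { subring_val : R; _ : subring_val \in S }.
HB.instance Definition _ := [isSub for subring_val].
HB.instance Definition _ := [Choice of subring_of by <:].
HB.instance Definition _ := GRing.SubChoice_isSubPzRing.Build _ _ subring_of
  (subringClosedP _).
End Subring.

(* Left ideals of [R] are the submodules of the left regular module [R^o];
   right ideals of [R] are the left ideals of the opposite ring [R^c]. *)
Definition left_noetherian (R : pzRingType) : Prop :=
  forall I : nat -> submodClosed R^o,
    (forall n, {subset I n <= I n.+1}) ->
  exists N, forall n, (N <= n)%N -> I n =i I N.

Definition right_noetherian (R : pzRingType) : Prop := left_noetherian R^c.

Definition noetherian (R : pzRingType) : Prop :=
  left_noetherian R /\ right_noetherian R.

Definition F_noetherian (R : pzRingType) : Prop :=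
  forall s : seq R, exists S : subringClosed R,
    {subset s <= S} /\ noetherian (subring_of S).

Structure filtration (R : pzRingType) := Filtration {
  fil :> nat -> zmodClosed R;
  fil_subset : forall m, {subset fil m <= fil m.+1};
  fil1 : 1 \in fil 0;
  filM : forall i j, {in fil i & fil j, forall x y, x * y \in fil (i + j)%N};
  fil_cover : forall x : R, exists m, x \in fil m
}.

Section AssociatedGraded.

Variables (R : pzRingType) (A : filtration R).
Implicit Types (m n i j : nat).

(* Membership in [A_{m-1}], with [A_{-1} = 0], inside [A_m]. *)
Definition fil_prev m : {pred subgroup_of (A m)} :=
  [pred x | if m is m'.+1 then val x \in A m' else val x == 0].

Fact fil_prev_closed m : zmod_closed (@fil_prev m).
Proof.
case: m => [|m]; split=> [|x y]; rewrite !inE ?raddf0 ?rpred0 //= ?raddfB.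
  by move=> /eqP-> /eqP->; rewrite subrr.
exact: rpredB.
Qed.
HB.instance Definition _ m :=
  GRing.isZmodClosed.Build _ (@fil_prev m) (@fil_prev_closed m).

(* The homogeneous component [A_m / A_{m-1}]. *)
Definition piece m := Quotient.quot (@fil_prev m).
HB.instance Definition _ m := GRing.Zmodule.on (piece m).

Fact piece_mul_subproof i j n (Dn : (i + j)%N = n)
  (x : subgroup_of (A i)) (y : subgroup_of (A j)) : val x * val y \in A n.
Proof. by rewrite -Dn; apply: filM; apply: valP. Qed.

(* The product [A_i/A_{i-1} x A_j/A_{j-1} -> A_n/A_{n-1}] for [n = i + j],
   computed on representatives; see [piece_mulE] for well-definedness. *)
Definition piece_mul i j n (Dn : (i + j)%N = n)
    (x : piece i) (y : piece j) : piece n :=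
  \pi_(piece n) (SubgroupOf (piece_mul_subproof Dn (repr x) (repr y))).

Lemma eq_piece m (x y : subgroup_of (A m)) :
  (\pi_(piece m) x == \pi_(piece m) y) = (x - y \in @fil_prev m).
Proof. by rewrite Quotient.idealrBE. Qed.

Lemma fil_prevMl i j n (Dn : (i + j)%N = n)
    (x : subgroup_of (A i)) (y : subgroup_of (A j)) :
  x \in @fil_prev i -> SubgroupOf (piece_mul_subproof Dn x y) \in @fil_prev n.
Proof.
case: n / Dn; rewrite !inE /=.
case: i x => [|i] x; first by move=> /eqP->; rewrite mul0r; case: (0 + j)%N;
  rewrite ?eqxx // => m; rewrite rpred0.
by move=> Ax; apply: filM => //; apply: valP.
Qed.

Lemma fil_prevMr i j n (Dn : (i + j)%N = n)
    (x : subgroup_of (A i)) (y : subgroup_of (A j)) :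
  y \in @fil_prev j -> SubgroupOf (piece_mul_subproof Dn x y) \in @fil_prev n.
Proof.
case: n / Dn; rewrite !inE /=.
case: j y => [|j] y; first by move=> /eqP->; rewrite mulr0; case: (i + 0)%N;
  rewrite ?eqxx // => m; rewrite rpred0.
by move=> Ay; rewrite addnS; apply: filM => //; apply: valP.
Qed.

Lemma piece_mulE i j n (Dn : (i + j)%N = n)
    (x : subgroup_of (A i)) (y : subgroup_of (A j)) :
  piece_mul Dn (\pi_(piece i) x) (\pi_(piece j) y) =
  \pi_(piece n) (SubgroupOf (piece_mul_subproof Dn x y)).
Proof.
have eq_repr m (z : subgroup_of (A m)) :
  repr (\pi_(piece m) z) - z \in @fil_prev m by rewrite -eq_piece reprK.
apply/eqP; rewrite eq_piece.
set x' := repr _; set y' := repr _.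
have -> : SubgroupOf (piece_mul_subproof Dn x' y') -
          SubgroupOf (piece_mul_subproof Dn x y) =
          SubgroupOf (piece_mul_subproof Dn (x' - x) y') +
          SubgroupOf (piece_mul_subproof Dn x (y' - y)) :> subgroup_of (A n).
  apply: val_inj => /=.
  by rewrite mulrBl mulrBr addrA subrK.
by apply: rpredD; [apply: fil_prevMl | apply: fil_prevMr]; apply: eq_repr.
Qed.

(* [symbol m a] is the class of [a] in [A_m / A_{m-1}] when [a \in A m]. *)
Definition symbol m (a : R) : piece m :=
  \pi_(piece m) (insubd (0 : subgroup_of (A m)) a).

Lemma symbol_val m (x : subgroup_of (A m)) : symbol m (val x) = \pi x.
Proof. by rewrite /symbol valKd. Qed.

Lemma symbol_repr m (x : piece m) : symbol m (val (repr x)) = x.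
Proof. by rewrite symbol_val reprK. Qed.

Lemma fil_repr m (x : piece m) : val (repr x) \in A m.
Proof. exact: valP. Qed.

Lemma symbol0 m : symbol m 0 = 0.
Proof.
by rewrite -(raddf0 (val : subgroup_of (A m) -> R)) symbol_val raddf0.
Qed.

Lemma symbolD m a b : a \in A m -> b \in A m ->
  symbol m (a + b) = symbol m a + symbol m b.
Proof.
move=> Aa Ab; pose x : subgroup_of (A m) := SubgroupOf Aa.
pose y : subgroup_of (A m) := SubgroupOf Ab.
rewrite (symbol_val (x + y)) (symbol_val x) (symbol_val y).
exact: (raddfD \pi_(piece m)).
Qed.

Lemma symbol_sum m (I : finType) (F : I -> R) :
  (forall k : I, F k \in A m) ->
  symbol m (\sum_k F k) = \sum_k symbol m (F k).
Proof.
move=> AF; suff [] : symbol m (\sum_k F k) = \sum_k symbol m (F k) /\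
  \sum_k F k \in A m by [].
apply: (big_ind2 (fun a x => symbol m a = x /\ a \in A m)) => //.
  by rewrite symbol0 rpred0.
by move=> a x b y [<- Aa] [<- Ab]; rewrite symbolD ?rpredD.
Qed.

Lemma symbolM i j n (Dn : (i + j)%N = n) a b : a \in A i -> b \in A j ->
  piece_mul Dn (symbol i a) (symbol j b) = symbol n (a * b).
Proof.
move=> Aa Ab; pose x : subgroup_of (A i) := SubgroupOf Aa.
pose y : subgroup_of (A j) := SubgroupOf Ab.
by rewrite (symbol_val x) (symbol_val y) piece_mulE -symbol_val.
Qed.

Lemma piece_mulDl i j n (Dn : (i + j)%N = n) z :
  {morph (fun x => @piece_mul i j n Dn x z) : x y / x + y}.
Proof.
move=> x y /=; rewrite -[x]symbol_repr -[y]symbol_repr -[z]symbol_repr.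
rewrite -symbolD ?fil_repr //; rewrite !symbolM ?rpredD ?fil_repr //.
by rewrite mulrDl symbolD // -Dn filM ?fil_repr.
Qed.

Lemma piece_mulDr i j n (Dn : (i + j)%N = n) z :
  {morph (@piece_mul i j n Dn z) : x y / x + y}.
Proof.
move=> x y /=; rewrite -[x]symbol_repr -[y]symbol_repr -[z]symbol_repr.
rewrite -symbolD ?fil_repr //; rewrite !symbolM ?rpredD ?fil_repr //.
by rewrite mulrDr symbolD // -Dn filM ?fil_repr.
Qed.

Lemma piece_mul0l i j n (Dn : (i + j)%N = n) x :
  @piece_mul i j n Dn 0 x = 0.
Proof.
by apply: (addrI (piece_mul Dn 0 x)); rewrite -piece_mulDl !addr0.
Qed.

Lemma piece_mul0r i j n (Dn : (i + j)%N = n) x :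
  @piece_mul i j n Dn x 0 = 0.
Proof.
by apply: (addrI (piece_mul Dn x 0)); rewrite -piece_mulDr !addr0.
Qed.

Definition finitely_supported (x : forall m, piece m) : Prop :=
  exists N, forall m, (N <= m)%N -> x m = 0.

(* The direct sum of the [piece m]. *)
Record gr := Gr {
  gr_comp :> forall m, piece m;
  _ : `[< finitely_supported gr_comp >]
}.
HB.instance Definition _ := [isSub for gr_comp].
HB.instance Definition _ := [Choice of gr by <:].

Lemma gr_supp (x : gr) : finitely_supported x.
Proof. exact/asboolP/(valP x). Qed.

Lemma eq_gr (x y : gr) : (forall m, x m = y m) -> x = y.
Proof. by move=> eq_xy; apply: val_inj; apply: functional_extensionality_dep. Qed.

Fact gr_zero_supp : `[< finitely_supported (fun m => 0) >].
Proof. by apply/asboolP; exists 0. Qed.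
Definition gr_zero := Gr gr_zero_supp.

Fact gr_opp_supp (x : gr) : `[< finitely_supported (fun m => - x m) >].
Proof.
by apply/asboolP; have [N xN] := gr_supp x; exists N => m /xN->; rewrite oppr0.
Qed.
Definition gr_opp x := Gr (gr_opp_supp x).

Fact gr_add_supp (x y : gr) : `[< finitely_supported (fun m => x m + y m) >].
Proof.
apply/asboolP; have [N xN] := gr_supp x; have [M yM] := gr_supp y.
by exists (maxn N M) => m; rewrite geq_max => /andP[/xN-> /yM->]; rewrite addr0.
Qed.
Definition gr_add x y := Gr (gr_add_supp x y).

Fact gr_addA : associative gr_add.
Proof. by move=> x y z; apply: eq_gr => m; apply: addrA. Qed.
Fact gr_addC : commutative gr_add.
Proof. by move=> x y; apply: eq_gr => m; apply: addrC. Qed.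
Fact gr_add0 : left_id gr_zero gr_add.
Proof. by move=> x; apply: eq_gr => m; apply: add0r. Qed.
Fact gr_addN : left_inverse gr_zero gr_opp gr_add.
Proof. by move=> x; apply: eq_gr => m; apply: addNr. Qed.
HB.instance Definition _ :=
  GRing.isZmodule.Build gr gr_addA gr_addC gr_add0 gr_addN.

Definition gr_one_comp m : piece m :=
  if m is 0 then \pi_(piece 0) (SubgroupOf (fil1 A)) else 0.
Fact gr_one_supp : `[< finitely_supported gr_one_comp >].
Proof. by apply/asboolP; exists 1 => -[]. Qed.
Definition gr_one := Gr gr_one_supp.

Definition gr_mul_comp (x y : gr) n : piece n :=
  \sum_(i < n.+1) piece_mul (subnKC (leq_ord i)) (x i) (y (n - i)%N).
Fact gr_mul_supp (x y : gr) : `[< finitely_supported (gr_mul_comp x y) >].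
Proof.
apply/asboolP; have [N xN] := gr_supp x; have [M yM] := gr_supp y.
exists (N + M)%N => n leNMn; apply: big1 => i _.
have [/xN->|ltiN] := leqP N i; first by rewrite piece_mul0l.
rewrite yM ?piece_mul0r // leq_subRL ?leq_ord //.
by apply: leq_trans leNMn; rewrite leq_add2r ltnW.
Qed.
Definition gr_mul x y := Gr (gr_mul_supp x y).

(* [a] picks representatives of the components of [x]. *)
Definition reps (x : gr) (a : nat -> R) : Prop :=
  forall m, a m \in A m /\ x m = symbol m (a m).

Lemma repsP x : exists a, reps x a.
Proof.
by exists (fun m => val (repr (x m))) => m; rewrite symbol_repr fil_repr.
Qed.

Lemma reps_inj x y a : reps x a -> reps y a -> x = y.
Proof. by move=> xa ya; apply: eq_gr => m; rewrite (xa m).2 (ya m).2. Qed.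

Lemma repsM x y a b : reps x a -> reps y b ->
  reps (gr_mul x y) (fun n => \sum_(i < n.+1) a i * b (n - i)%N).
Proof.
move=> xa yb n.
have Aab (i : 'I_n.+1) : a i * b (n - i)%N \in A n.
  by rewrite -[X in A X](subnKC (leq_ord i)) filM ?(xa _).1 ?(yb _).1.
split; first exact: rpred_sum.
rewrite symbol_sum //; apply: eq_bigr => i _.
by rewrite (xa i).2 (yb _).2 symbolM ?(xa _).1 ?(yb _).1.
Qed.

Lemma reps1 : reps gr_one (fun m => (m == 0)%:R).
Proof.
case=> [|m]; rewrite ?rpred0 ?symbol0 ?fil1 //=; split=> //.
by rewrite -symbol_val.
Qed.

Fact gr_mulA : associative gr_mul.
Proof.
move=> x y z; have [a xa] := repsP x; have [b yb] := repsP y.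
have [c zc] := repsP z.
apply: (reps_inj (repsM xa (repsM yb zc))).
have := repsM (repsM xa yb) zc; congr (reps _ _); apply/funext => n.
pose coef3 j k := a j * (b (n - j - k)%N * c k).
transitivity (\sum_(j < n.+1) \sum_(k < n.+1 | (k <= n - j)%N) coef3 j k);
  last first.
  apply: eq_bigr => /= j _; rewrite big_distrr /=.
  rewrite (big_ord_narrow_leq (leq_subr _ _)) /= (reindex_inj rev_ord_inj) /=.
  by apply: eq_bigr => k _; rewrite /coef3 !subSS subKn // -ltnS.
rewrite (exchange_big_dep predT) //=; rewrite (reindex_inj rev_ord_inj) /=.
apply: eq_bigr => k _; rewrite !subSS subKn ?leq_ord //.
transitivity (\sum_(j < n.+1 | (j <= n - k)%N) coef3 j k); last first.
  by apply: eq_bigl => j; rewrite !leq_subRL ?leq_ord // addnC.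
rewrite (big_ord_narrow_leq (leq_subr _ _)) big_distrl /=.
by apply: eq_bigr => j _; rewrite /coef3 -!subnDA addnC mulrA.
Qed.

Fact gr_mul1l : left_id gr_one gr_mul.
Proof.
move=> x; have [a xa] := repsP x; apply: (reps_inj (repsM reps1 xa)).
suff <- : a = (fun n => \sum_(i < n.+1) (i == 0 :> nat)%:R * a (n - i)%N) by [].
apply/funext => n; rewrite big_ord_recl subn0 mul1r big1 ?addr0 // => i _.
by rewrite mul0r.
Qed.

Fact gr_mul1r : right_id gr_one gr_mul.
Proof.
move=> x; have [a xa] := repsP x; apply: (reps_inj (repsM xa reps1)).
suff <- : a = (fun n => \sum_(i < n.+1) a i * (n - i == 0)%N%:R) by [].
apply/funext => n; rewrite big_ord_recr /= subnn mulr1 big1 ?add0r // => i _.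
by rewrite subn_eq0 leqNgt ltn_ord mulr0.
Qed.

Fact gr_mulDl : left_distributive gr_mul +%R.
Proof.
move=> x y z; apply: eq_gr => n; rewrite /= -big_split /=.
by apply: eq_bigr => i _; rewrite piece_mulDl.
Qed.

Fact gr_mulDr : right_distributive gr_mul +%R.
Proof.
move=> x y z; apply: eq_gr => n; rewrite /= -big_split /=.
by apply: eq_bigr => i _; rewrite piece_mulDr.
Qed.

HB.instance Definition _ := GRing.Zmodule_isPzRing.Build gr
  gr_mulA gr_mul1l gr_mul1r gr_mulDl gr_mulDr.

End AssociatedGraded.

(* Main.v *)
Require Import Defs.
From mathcomp Require Import all_boot all_algebra.
From HB Require Import structures.
From mathcomp Require Import boolp generic_quotient ring.

(** The commutativity of the associated graded ring says very little about a
    ring whose filtration reaches the whole ring in one step.  Let [R] be any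
    ring with [1 + 1 = 0] and take the chain [{0, 1}], [R], [R], ...  All axioms
    of a filtration hold, and its graded ring is [F_2] plus an ideal
    [M = R / {0, 1}] placed in degree one, so [M] has square zero because
    degree two vanishes.  Such a ring is commutative
    ([sqr0_coset_comm]), and finitely many of its elements generate a finite
    subring ([sqr0_coset_F_noetherian]), so it is F-noetherian.

    It remains to find a ring [R] of characteristic two that is not
    F-noetherian.  In the ring of triangular matrices with rows [p, q] and
    [0, p(0)], where [p] and [q] are polynomials, the matrices with [p = 0]
    form an ideal on which right multiplication only acts through scalars.  So
    the bound [deg q < n] cuts out a right ideal for every [n].  Any
    subring that contains ['X] ([p = 'X], [q = 0]) and [u] ([p = 0], [q = 1])
    contains all the ['X^n * u], and these show that the chain of right ideals
    stays strict inside that subring ([augext_not_F_noetherian]). *)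

Set Implicit Arguments.
Unset Strict Implicit.
Unset Printing Implicit Defensive.

Import GRing.Theory.
Local Open Scope ring_scope.

(** * Finite rings are noetherian *)

(** Membership of each single element in an ascending chain is eventually
    constant; finitely many elements stabilise simultaneously. *)
Lemma chain_stable_on (T : eqType) (P : nat -> pred T) (t : seq T) :
    (forall n x, P n x -> P n.+1 x) ->
  exists N, forall n, (N <= n)%N -> {in t, P n =1 P N}.
Proof.
move=> incP; have monoP m n x : (m <= n)%N -> P m x -> P n x.
  by move=> /subnK <-; elim: (n - m)%N => // k IH /IH; apply: incP.
elim: t => [|a t [N stN]]; first by exists 0%N.
have [[k Pka]|nPa] := pselect (exists k, P k a).
  exists (maxn N k) => n; rewrite geq_max => /andP[leNn lekn] x.
  rewrite inE => /orP[/eqP->|tx].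
    by rewrite (monoP k n) // (monoP k (maxn N k)) // leq_maxr.
  by rewrite (stN n) // (stN (maxn N k)) // leq_maxl.
exists N => n leNn x; rewrite inE => /orP[/eqP->|]; last exact: stN.
by apply/idP/idP => Pa; case: nPa; [exists n | exists N].
Qed.

Lemma finite_left_noetherian (R : pzRingType) (t : seq R) :
  (forall x, x \in t) -> left_noetherian R.
Proof.
move=> tP I incI.
have [N stN] := @chain_stable_on R (fun n x => x \in I n) t incI.
by exists N => n leNn x; apply: stN.
Qed.

Lemma finite_noetherian (R : pzRingType) (t : seq R) :
  (forall x, x \in t) -> noetherian R.
Proof.
by move=> tP; split; [exact: finite_left_noetherian tP |
  exact: (@finite_left_noetherian R^c t tP)].
Qed.

(** * Finite subrings in characteristic two *)

Section SubsetSums.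
Variable G : pzRingType.
Hypothesis char2 : 1 + 1 = 0 :> G.
Implicit Types (x y a b : G) (l : seq G).

(** In characteristic two these are all the integral linear combinations of
    the entries of [l]. *)
Fixpoint subset_sums l : seq G :=
  if l is a :: l' then subset_sums l' ++ map (+%R a) (subset_sums l')
  else [:: 0].

Lemma addxx_char2 x : x + x = 0.
Proof. by rewrite -[x]mul1r -mulrDl char2 mul0r. Qed.

Lemma oppr_char2 x : - x = x.
Proof. by apply/eqP; rewrite -subr_eq0 -opprD addxx_char2 oppr0. Qed.

Lemma mem_subset_sums_cons a l x :
  (x \in subset_sums (a :: l)) = (x \in subset_sums l) || (a + x \in subset_sums l).
Proof.
rewrite /= mem_cat; congr (_ || _); apply/mapP/idP => [[y ly ->]|lax].
  by rewrite addrA addxx_char2 add0r.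
by exists (a + x); rewrite // addrA addxx_char2 add0r.
Qed.

Lemma subset_sums0 l : 0 \in subset_sums l.
Proof. by elim: l => [|a l IH]; rewrite ?inE // mem_subset_sums_cons IH. Qed.

Lemma subset_sumsD l x y :
  x \in subset_sums l -> y \in subset_sums l -> x + y \in subset_sums l.
Proof.
elim: l x y => [|a l IH] x y; first by rewrite !inE => /eqP-> /eqP->; rewrite addr0.
rewrite !mem_subset_sums_cons => /orP[] lx /orP[] ly.
- by rewrite (IH _ _ lx ly).
- by rewrite addrCA (IH _ _ lx ly) orbT.
- by rewrite addrA (IH _ _ lx ly) orbT.
by have := IH _ _ lx ly; rewrite addrACA addxx_char2 add0r => ->.
Qed.

Lemma mem_subset_sums l : {subset l <= subset_sums l}.
Proof.
elim: l => // a l IH x; rewrite inE mem_subset_sums_cons => /orP[/eqP->|/IH->//].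
by rewrite addxx_char2 subset_sums0 orbT.
Qed.

Lemma subset_sums_ind (P : G -> Prop) l :
    P 0 -> (forall x y, P x -> P y -> P (x + y)) -> {in l, forall a, P a} ->
  {in subset_sums l, forall x, P x}.
Proof.
move=> P0 PD; elim: l => [|a l IH] Pl x; first by rewrite inE => /eqP->.
have {}IH := IH (fun b lb => Pl b (@mem_behead _ (a :: l) b lb)).
rewrite mem_subset_sums_cons => /orP[/IH //|/IH Pax].
rewrite -[x]add0r -(addxx_char2 a) -addrA.
by apply: PD => //; apply: Pl; rewrite mem_head.
Qed.

Lemma subset_sumsM l :
    {in l &, forall a b, a * b \in subset_sums l} ->
  {in subset_sums l &, forall x y, x * y \in subset_sums l}.
Proof.
move=> lM x y lx ly; move: x lx.
apply: subset_sums_ind => [|x x' ? ?|a la]; first by rewrite mul0r subset_sums0.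
  by rewrite mulrDl subset_sumsD.
move: y ly; apply: subset_sums_ind => [|y y' ? ?|b lb]; last exact: lM.
  by rewrite mulr0 subset_sums0.
by rewrite mulrDr subset_sumsD.
Qed.

Lemma subset_sums_subring_closed l :
    1 \in l -> {in l &, forall a b, a * b \in subset_sums l} ->
  subring_closed (fun x => x \in subset_sums l).
Proof.
move=> l1 lM; split=> [|x y lx ly|x y lx ly]; rewrite /in_mem /=.
- exact: mem_subset_sums.
- by rewrite oppr_char2; apply: subset_sumsD.
exact: subset_sumsM.
Qed.

Lemma finite_subring_noetherian (S : subringClosed G) l :
  S =i l -> noetherian (subring_of S).
Proof.
move=> Sl; apply: (@finite_noetherian _ (pmap insub l)) => x.
by rewrite mem_pmap_sub -Sl; apply: valP.
Qed.

End SubsetSums.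

(** * Square-zero extensions of the field with two elements *)

Section SquareZero.
Variables (G : pzRingType) (M : G -> Prop).
Hypothesis char2 : 1 + 1 = 0 :> G.
Hypothesis sqr0M : forall x y, M x -> M y -> x * y = 0.
Hypothesis coverM : forall x, M x \/ M (1 + x).

Lemma sqr0_coset_comm (x y : G) : x * y = y * x.
Proof.
(* Adding 1 to either factor does not change the commutator. *)
have comm1 (a b : G) : (1 + a) * b = b * (1 + a) -> a * b = b * a.
  by rewrite mulrDl mulrDr mul1r mulr1 => /addrI.
have commM (a b : G) : M a -> M b -> a * b = b * a by move=> *; rewrite !sqr0M.
have [Mx|Mx] := coverM x; have [My|My] := coverM y.
- exact: commM.
- by apply/esym/comm1/esym/commM.
- exact/comm1/commM.
by apply/comm1/esym/comm1/esym/commM.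
Qed.

(** The finitely many given elements may be moved into [M] by adding [1]; then
    [1] and these multiply among the linear combinations of themselves. *)
Lemma sqr0_coset_F_noetherian : F_noetherian G.
Proof.
move=> s; pose shift (x : G) := if `[< M x >] then x else 1 + x.
have Mshift x : M (shift x).
  by rewrite /shift; case: asboolP => // ?; case: (coverM x).
pose l := 1 :: map shift s.
have lM : {in l &, forall a b, a * b \in subset_sums l}.
  move=> a b; rewrite !inE => /orP[/eqP->|/mapP[x sx ->]] lb.
    by rewrite mul1r mem_subset_sums // inE.
  case/orP: lb => [/eqP->|/mapP[y sy ->]].
    by rewrite mulr1 mem_subset_sums // inE map_f ?orbT.
  by rewrite sqr0M ?subset_sums0.
pose S := HB.pack_for (subringClosed G) (fun x : G => x \in subset_sums l)
  (GRing.isSubringClosed.Build G _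
    (subset_sums_subring_closed char2 (mem_head _ _) lM)).
exists S; split; last exact: (@finite_subring_noetherian _ S (subset_sums l)).
move=> x sx; have l1 : 1 \in subset_sums l by rewrite mem_subset_sums ?mem_head.
have : shift x \in subset_sums l by rewrite mem_subset_sums // inE map_f ?orbT.
rewrite /shift; case: asboolP => // _ /(subset_sumsD char2 l1).
by rewrite addrA char2 add0r.
Qed.

End SquareZero.

(** * The one-step filtration *)

Section OneStep.
Variable R : pzRingType.
Hypothesis char2 : 1 + 1 = 0 :> R.

Definition one_step (m : nat) : {pred R} :=
  fun x => if m is 0 then x \in [:: 0; 1] else true.

Lemma mem_one_step0 x : (x \in one_step 0) = (x == 0) || (x == 1).
Proof. by rewrite -[LHS]/(x \in [:: 0; 1]) !inE. Qed.

Lemma one_step_zmod_closed m : zmod_closed (one_step m).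
Proof.
case: m => [|m]; split=> //; first by rewrite mem_one_step0 eqxx.
move=> x y; rewrite !mem_one_step0 => /orP[]/eqP-> /orP[]/eqP->; rewrite ?subrr ?subr0 ?eqxx ?orbT //.
by rewrite oppr_char2 // add0r eqxx orbT.
Qed.

Definition one_step_zmod m : zmodClosed R :=
  HB.pack_for (zmodClosed R) (one_step m)
    (GRing.isZmodClosed.Build R _ (one_step_zmod_closed m)).

Lemma one_step_subset m : {subset one_step_zmod m <= one_step_zmod m.+1}.
Proof. by []. Qed.

Lemma one_step1 : 1 \in one_step_zmod 0.
Proof. by rewrite mem_one_step0 eqxx orbT. Qed.

Lemma one_stepM i j :
  {in one_step_zmod i & one_step_zmod j, forall x y, x * y \in one_step_zmod (i + j)%N}.
Proof.
case: i j => [|i] [|j] x y //; rewrite !mem_one_step0.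
by move=> /orP[]/eqP-> /orP[]/eqP->; rewrite ?mul0r ?mul1r eqxx ?orbT.
Qed.

Lemma one_step_cover x : exists m, x \in one_step_zmod m.
Proof. by exists 1%N. Qed.

Definition one_step_filtration : filtration R :=
  Filtration one_step_subset one_step1 one_stepM one_step_cover.

Local Notation A := one_step_filtration.

Lemma one_step_piece_eq0 m (x : piece A m.+2) : x = 0.
Proof.
rewrite -[x]symbol_repr -(symbol0 A m.+2) /symbol.
by apply/eqP; rewrite eq_piece unfold_in.
Qed.

Lemma one_step_gr1 : (1 : gr A) 0 = symbol A 0 1.
Proof. exact/esym/(symbol_val (SubgroupOf (fil1 A))). Qed.

Lemma one_step_gr_char2 : 1 + 1 = 0 :> gr A.
Proof.
apply: eq_gr => -[|m]; last exact: addr0.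
rewrite -[LHS]/((1 : gr A) 0 + (1 : gr A) 0) one_step_gr1.
by rewrite -symbolD ?fil1 // char2 symbol0.
Qed.

Lemma one_step_gr_sqr0 (x y : gr A) : x 0 = 0 -> y 0 = 0 -> x * y = 0.
Proof.
move=> x0 y0; apply: eq_gr => -[|[|m]] /=; last exact: one_step_piece_eq0.
  by apply: big1 => -[[|i] //= lti] _; rewrite x0 piece_mul0l.
apply: big1 => -[[|[|i]] //= lti] _; first by rewrite x0 piece_mul0l.
by rewrite y0 piece_mul0r.
Qed.

Lemma one_step_gr_cover (x : gr A) : x 0 = 0 \/ (1 + x) 0 = 0.
Proof.
rewrite -[(1 + x) 0]/((1 : gr A) 0 + x 0) one_step_gr1.
rewrite -(symbol_repr (x 0)); move: (fil_repr (x 0)).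
rewrite mem_one_step0 => /orP[]/eqP->; [left|right]; first exact: symbol0.
by rewrite -symbolD ?fil1 // char2 symbol0.
Qed.

Lemma one_step_gr_comm (x y : gr A) : x * y = y * x.
Proof. exact: sqr0_coset_comm one_step_gr_sqr0 one_step_gr_cover x y. Qed.

Lemma one_step_gr_F_noetherian : F_noetherian (gr A).
Proof.
exact: sqr0_coset_F_noetherian one_step_gr_char2 one_step_gr_sqr0 one_step_gr_cover.
Qed.

End OneStep.

(** * A ring that is not F-noetherian *)

(** The pair [(p, q)] stands for the triangular matrix with rows [p, q] and
    [0, p(0)]. *)
Definition augext (K : comNzRingType) : Type := ({poly K} * {poly K})%type.

Section AugmentationExtension.
Variable K : comNzRingType.
Implicit Types (x y z : augext K).

HB.instance Definition _ := GRing.Zmodule.on (augext K).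

Definition augext_one : augext K := (1, 0).
Definition augext_mul x y : augext K :=
  (x.1 * y.1, x.1 * y.2 + x.2 * (y.1.[0])%:P).

Lemma augext_mulA : associative augext_mul.
Proof.
move=> [p q] [p' q'] [p'' q'']; rewrite /augext_mul /= hornerM polyCM.
by congr (_, _); ring.
Qed.

Lemma augext_mul1l : left_id augext_one augext_mul.
Proof. by move=> [p q]; rewrite /augext_mul /= !mul1r mul0r addr0. Qed.

Lemma augext_mul1r : right_id augext_one augext_mul.
Proof. by move=> [p q]; rewrite /augext_mul /= hornerC !mulr1 mulr0 add0r. Qed.

Lemma augext_mulDl : left_distributive augext_mul +%R.
Proof.
move=> [p q] [p' q'] [p'' q'']; rewrite /augext_mul /=.
by congr (_, _) => /=; ring.
Qed.

Lemma augext_mulDr : right_distributive augext_mul +%R.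
Proof.
move=> [p q] [p' q'] [p'' q'']; rewrite /augext_mul /= hornerD polyCD.
by congr (_, _) => /=; ring.
Qed.

HB.instance Definition _ := GRing.Zmodule_isPzRing.Build (augext K)
  augext_mulA augext_mul1l augext_mul1r augext_mulDl augext_mulDr.

Definition augextX : augext K := ('X, 0).
Definition augextU : augext K := (0, 1).

Lemma augextXnU n : augextX ^+ n * augextU = (0, 'X^n).
Proof.
elim: n => [|n IH]; first by rewrite expr0 mul1r.
rewrite exprS -mulrA IH; congr (_, _); rewrite /= ?mulr0 //.
by rewrite mul0r addr0 exprS.
Qed.

Section RightIdeals.
Variable S : subringClosed (augext K).

Definition corner_ideal n : {pred (subring_of S)^c^o} :=
  fun z : subring_of S => ((subring_val z).1 == 0) && (size (subring_val z).2 <= n)%N.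

Lemma mem_corner_ideal n (z : subring_of S) p q :
    subring_val z = (p, q) ->
  (z \in corner_ideal n) = (p == 0) && (size q <= n)%N.
Proof. by rewrite unfold_in => ->. Qed.

(** Scaling is right multiplication, which multiplies the corner entry by a
    constant and so does not raise its degree. *)
Lemma corner_ideal_submod_closed n : submod_closed (corner_ideal n).
Proof.
split=> [|a u v]; first by rewrite /corner_ideal unfold_in /= eqxx size_poly0.
rewrite /corner_ideal !unfold_in => /andP[/eqP u0 su] /andP[/eqP v0 sv].
have -> : subring_val (a *: u + v) =
  subring_val u * subring_val a + subring_val v by [].
move: (subring_val u) (subring_val a) (subring_val v) u0 su v0 sv => /=.
move=> [p q] [p' q'] [p'' q''] /= -> sq -> sq''.
rewrite !mul0r addr0 eqxx add0r /=.
apply: leq_trans (size_polyD _ _) _; rewrite geq_max sq'' andbT.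
by rewrite mulrC mul_polyC (leq_trans (size_scale_leq _ _)).
Qed.

Definition corner_ideal_submod n : submodClosed (subring_of S)^c^o :=
  HB.pack_for (submodClosed (subring_of S)^c^o) (corner_ideal n)
    (GRing.isSubmodClosed.Build _ _ _ (corner_ideal_submod_closed n)).

Lemma not_right_noetherian_XU :
  augextX \in S -> augextU \in S -> ~ right_noetherian (subring_of S).
Proof.
move=> SX SU /(_ corner_ideal_submod) [] => [n z|N stN].
  by rewrite !unfold_in => /andP[-> /leqW].
have SXU : augextX ^+ N * augextU \in S by rewrite rpredM ?rpredX.
have := stN N.+1 (leqnSn N) (SubringOf SXU).
rewrite !(mem_corner_ideal _ (z := SubringOf SXU) (augextXnU N)).
by rewrite size_polyXn eqxx ltnn leqnn.
Qed.

End RightIdeals.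

Lemma augext_not_F_noetherian : ~ F_noetherian (augext K).
Proof.
move=> /(_ [:: augextX; augextU])[S [sS [_]]].
by apply: not_right_noetherian_XU; apply: sS; rewrite !inE eqxx ?orbT.
Qed.

End AugmentationExtension.

Lemma augext_char2 : 1 + 1 = 0 :> augext 'F_2.
Proof.
congr (_, _); last exact: addr0.
by rewrite /= -polyCD (_ : 1 + 1 = 0 :> 'F_2) //; apply/val_inj.
Qed.

Theorem mainTheorem11 :
  exists (R : pzRingType) (A : filtration R),
    (forall x y : gr A, (x * y = y * x)%R) /\
    F_noetherian (gr A) /\
    ~ F_noetherian R.
Proof.
exists (augext 'F_2), (one_step_filtration augext_char2).
split; first exact: one_step_gr_comm.
by split; [exact: one_step_gr_F_noetherian | exact: augext_not_F_noetherian].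
Qed.
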